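(* Let $n\ge 1$, let $R\subseteq\mathbb{Z}^n_{\geq 0}$ be a set of points satisfying the monomial condition, and let $\ell$ be a positive integer. Then \[L_R\,\mathcal S_{R,\ell}=V_{R,\ell}.\]
   Context: Notation: for ${\bf k},{\bf i}\in\mathbb{Z}^n_{\geq 0}$, $|{\bf k}|=k_1+\cdots+k_n$, ${\bf k}!=k_1!\cdots k_n!$, ${\bf i}\le{\bf k}$ means $i_j\le k_j$ for all $j$, and $\binom{\bf k}{\bf i}=\prod_{j=1}^n\binom{k_j}{i_j}$, with $\binom{\bf k}{\bf i}=0$ if ${\bf i}\not\le{\bf k}$. Monomial condition: $R$ satisfies the monomial condition if there is a monomial ideal $J\subseteq\mathbb{C}[x_1,\ldots,x_n]$ such that $R$ is the set of exponent vectors of the monomials not belonging to $J$ (identifying $x_1^{a_1}\cdots x_n^{a_n}$ with $(a_1,\ldots,a_n)$). $R$ may be finite or infinite. Pascal matrix: $L_R=\big(\binom{\bf k}{\bf k'}\big)_{{\bf k},{\bf k'}\in R}$ (row ${\bf k}$, column ${\bf k'}$). The set $R$, and hence the rows and columns indexed by it, is ordered by the total order $<_T$: ${\bf k}<_T{\bf k'}$ iff $|{\bf k}|<|{\bf k'}|$, or $|{\bf k}|=|{\bf k'}|$ and the left-most nonzero entry of ${\bf k'}-{\bf k}$ is negative. Each row of $L_R$ has finitely many nonzero entries, so the product is well defined even if $R$ is infinite. Stirling polynomials of second kind: for ${\bf k}\in\mathbb{Z}^n_{\geq 0}$ and $j\in\mathbb{Z}_{\ge 0}$, the polynomials $S_{\bf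 k}^{(j)}(x_0,x_1,\ldots,x_n)$ are defined by the generating function \[\frac{1}{{\bf k}!}e^{x_0t}\prod_{i=1}^n\big(e^{x_it}-1\big)^{k_i}=\sum_{j=0}^\infty S_{\bf k}^{(j)}(x_0,x_1,\ldots,x_n)\frac{t^j}{j!}.\] Linear forms: $A_{\bf k}=x_0+k_1x_1+\cdots+k_nx_n$ for ${\bf k}\in\mathbb{Z}^n_{\geq 0}$. Vandermonde matrix and generalized factorial Stirling matrix, both of size $|R|\times(\ell+1)$ with rows indexed by $R$ (in its order) and columns by $0\le j\le\ell$: \[V_{R,\ell}=\big(A_{\bf k}^j\big)_{{\bf k}\in R,\ 0\leq j\leq\ell},\qquad \mathcal S_{R,\ell}=\big({\bf k}!\,S_{\bf k}^{(j)}\big)_{{\bf k}\in R,\ 0\leq j\leq\ell}.\] The identity is one of matrices over $\mathbb{Z}[x_0,\ldots,x_n]$. *)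

(* Defs.v *)
From HB Require Import structures.
From mathcomp Require Import all_boot all_order all_algebra.
From mathcomp Require Import complex Rstruct.
From mathcomp Require Import boolp classical_sets cardinality fsbigop.
From mathcomp Require Import mpoly.

Set Implicit Arguments.
Unset Strict Implicit.
Unset Printing Implicit Defensive.

Import Order.TTheory GRing.Theory Num.Theory.

Local Open Scope ring_scope.
Local Open Scope classical_set_scope.

(* An alias of 'X_{1..n}, on which the library already puts the degree-
   lexicographic order; <_T breaks the ties the other way round. *)
Definition mindex (n : nat) : Type := 'X_{1..n}.
HB.instance Definition _ n := Choice.copy (mindex n) 'X_{1..n}.
Definition mnm_of_mindex n (k : mindex n) : 'X_{1..n} := k.
Coercion mnm_of_mindex : mindex >-> multinom.

Section TotalOrder.
Context {n : nat}.
Implicit Types k : mindex n.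

Definition ltT k (k' : mindex n) : bool :=
  (mdeg k < mdeg k')%N ||
  (mdeg k == mdeg k') &&
    [exists i : 'I_n, (k' i < k i)%N &&
       [forall j : 'I_n, (j < i)%N ==> (k' j == k j)]].

Lemma ltT_irr : irreflexive ltT.
Proof.
move=> k; rewrite /ltT ltnn eqxx /=; apply/existsP; case=> i.
by rewrite ltnn.
Qed.

Lemma ltT_trans : transitive ltT.
Proof.
move=> k2 k1 k3 /orP[d12|/andP[/eqP d12 /existsP[i /andP[i12 /forallP h12]]]].
  case/orP=> [d23|/andP[/eqP d23 _]]; apply/orP; left; last by rewrite -d23.
  exact: ltn_trans d23.
case/orP=> [d23|/andP[/eqP d23 /existsP[j /andP[j23 /forallP h23]]]].
  by apply/orP; left; rewrite d12.
apply/orP; right; rewrite d12 d23 eqxx /=.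
case: (ltngtP i j) => [ij|ji|/val_inj eij].
- apply/existsP; exists i; move: (h23 i); rewrite ij => /eqP ->; rewrite i12 /=.
  apply/forallP => l; apply/implyP => li.
  by move: (h12 l) (h23 l); rewrite li (ltn_trans li ij) => /eqP <- /eqP ->.
- apply/existsP; exists j; move: (h12 j); rewrite ji => /eqP <-; rewrite j23 /=.
  apply/forallP => l; apply/implyP => lj.
  by move: (h12 l) (h23 l); rewrite lj (ltn_trans lj ji) => /eqP <- /eqP ->.
- apply/existsP; exists i; rewrite -eij in j23 h23.
  rewrite (ltn_trans j23 i12) /=.
  apply/forallP => l; apply/implyP => li.
  by move: (h12 l) (h23 l); rewrite li => /eqP <- /eqP ->.
Qed.

Lemma ltT_total k (k' : mindex n) : k != k' -> ltT k k' || ltT k' k.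
Proof.
move=> nkk'; rewrite /ltT; case: (ltngtP (mdeg k) (mdeg k')) => //= _.
have [i0 hi0] : exists i : 'I_n, k i != k' i.
  apply/existsP; apply: contraNT nkk' => /existsPn h.
  by apply/eqP/mnmP => i; apply/eqP; have := h i; rewrite negbK.
case: (@arg_minnP _ i0 (fun i => k i != k' i) (fun i : 'I_n => val i) hi0)
  => i hi mini.
have heq (j : 'I_n) : (j < i)%N -> k j = k' j.
  by move=> ji; apply/eqP; apply: contraTT ji => /mini; rewrite -leqNgt.
apply/orP; move: hi; case: (ltngtP (k i) (k' i)) => // hlt _; [right|left];
  apply/existsP; exists i; rewrite hlt /=;
  by apply/forallP => j; apply/implyP => /heq ->.
Qed.

End TotalOrder.

Fact ltT_display : Order.disp_t. Proof. exact: (Order.Disp tt tt). Qed.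

HB.instance Definition _ n := Order.LtOrder.Build ltT_display (mindex n)
  (fun _ _ => erefl) (fun _ _ => erefl) (fun _ _ => erefl)
  (@ltT_irr n) (@ltT_trans n) (@ltT_total n).

Definition is_ideal (A : comNzRingType) (J : set A) : Prop :=
  [/\ J 0, (forall p q, J p -> J q -> J (p + q)) &
      (forall p q, J q -> J (p * q))].

Definition ideal_gen (A : comNzRingType) (G : set A) : set A :=
  [set p | forall J : set A, is_ideal J -> G `<=` J -> J p].

Definition monomial_ideal (F : fieldType) (n : nat) (J : set {mpoly F[n]}) :=
  exists M : set 'X_{1..n}, J = ideal_gen [set 'X_[m] | m in M].

Definition monomial_condition (n : nat) (R : set (mindex n)) : Prop :=
  exists J : set {mpoly (complex Rdefinitions.R)[n]},
    monomial_ideal J /\ R = [set k | ~ J 'X_[k]].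

(* The elements of R as an ordered type: it inherits the order <_T. *)
Definition index_of (n : nat) (R : set (mindex n)) : Type := {k | k \in R}.
HB.instance Definition _ n R := SubChoice.copy (@index_of n R) {k | k \in R}.
HB.instance Definition _ n R :=
  [SubChoice_isSubOrder of @index_of n R by <: with ltT_display].

Lemma index_ltE n (R : set (mindex n)) (k k' : index_of R) :
  (k < k')%O = ltT (val k) (val k').
Proof. by []. Qed.

(* Matrices whose rows and columns are indexed by possibly infinite ordered
   sets. *)
Definition omatrix {d d'} (A : Type) (I : orderType d) (J : orderType d') :=
  I -> J -> A.

(* The finitely supported sum has value 0 if infinitely many summands are
   nonzero; see pascal_mx_finite_row. *)
Definition omulmx {d1 d2 d3} {A : pzRingType}
    {I : orderType d1} {J : orderType d2} {K : orderType d3}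
    (M : omatrix A I J) (N : omatrix A J K) : omatrix A I K :=
  fun i k => \sum_(j \in [set: J]) M i j * N j k.

(* A power series in t is the sequence of its coefficients. *)
Section PowerSeries.
Context {A : comAlgType rat}.
Implicit Types a b : nat -> A.

Definition ps_one : nat -> A := fun j => (j == 0)%:R.
Definition ps_sub a b : nat -> A := fun j => a j - b j.
Definition ps_scale (c : rat) a : nat -> A := fun j => c *: a j.
Definition ps_mul a b : nat -> A := fun j => \sum_(i < j.+1) a i * b (j - i)%N.
Definition ps_pow a (m : nat) : nat -> A := iter m (ps_mul a) ps_one.

(* e^{ct} *)
Definition ps_expt (c : A) : nat -> A := fun j => (j`!%:R : rat)^-1 *: c ^+ j.

End PowerSeries.

Definition mindex_fact n (k : mindex n) : nat := \prod_(i < n) (k i)`!.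
Definition mindex_bin n (k k' : mindex n) : nat := \prod_(i < n) 'C(k i, k' i).

(* The polynomials of the generating function live over Q; their integrality,
   needed to read the Stirling polynomials in Z[x_0, ..., x_n], is proved
   below in stirling2_exists. *)
Definition stirling2_series n (k : mindex n) : nat -> {mpoly rat[n.+1]} :=
  ps_scale (mindex_fact k)%:R^-1
    (ps_mul (ps_expt 'X_ord0)
       (\big[ps_mul/ps_one]_(i < n)
          ps_pow (ps_sub (ps_expt 'X_(lift ord0 i)) ps_one) (k i))).

Section Integrality.
Context {n : nat}.
Local Notation A := {mpoly rat[n]}.
Local Notation toQ := (map_mpoly (intr : int -> rat)).
Implicit Types (a b : nat -> A) (c : A).

Definition integral c := exists p : {mpoly int[n]}, toQ p = c.

Definition egf_integral a := forall j, integral ((j`!%:R : rat) *: a j).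

Lemma integralD c c' : integral c -> integral c' -> integral (c + c').
Proof. by case=> p <- [q <-]; exists (p + q); rewrite rmorphD. Qed.

Lemma integralM c c' : integral c -> integral c' -> integral (c * c').
Proof. by case=> p <- [q <-]; exists (p * q); rewrite rmorphM. Qed.

Lemma integral_nat m : integral m%:R.
Proof. by exists m%:R; rewrite rmorph_nat. Qed.

Lemma integralX i : integral 'X_i.
Proof. by exists 'X_i; rewrite map_mpolyX. Qed.

Lemma integral_exp c m : integral c -> integral (c ^+ m).
Proof. by case=> p <-; exists (p ^+ m); rewrite rmorphXn. Qed.

Lemma integral_sum (I : Type) (r : seq I) (F : I -> A) :
  (forall i, integral (F i)) -> integral (\sum_(i <- r) F i).
Proof.
move=> h; apply: (big_ind integral) => //; first exact: (integral_nat 0).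
exact: integralD.
Qed.

Lemma fact_neq0 m : (m`!%:R : rat) != 0.
Proof. by rewrite pnatr_eq0 -lt0n fact_gt0. Qed.

Lemma egf_integral_one : egf_integral (ps_one : nat -> A).
Proof. by move=> j; rewrite /ps_one scaler_nat -mulrnA; apply: integral_nat. Qed.

Lemma egf_integral_mul a b :
  egf_integral a -> egf_integral b -> egf_integral (ps_mul a b).
Proof.
move=> ha hb j; rewrite /ps_mul scaler_sumr; apply: integral_sum => i.
have ij : (i <= j)%N by rewrite -ltnS.
suff -> : (j`!%:R : rat) *: (a i * b (j - i)%N) =
    'C(j, i)%:R * ((i`!%:R : rat) *: a i *
                   (((j - i)`!%:R : rat) *: b (j - i)%N)).
  by apply: integralM; [exact: integral_nat | exact: integralM].
rewrite mulr_natl -scaler_nat -scalerAl -[X in _ *: (_ *: X)]scalerAr !scalerA.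
by rewrite -!natrM -mulnA bin_fact.
Qed.

Lemma egf_integral_expt c : integral c -> egf_integral (ps_expt c).
Proof.
move=> hc j; rewrite /ps_expt scalerA mulfV ?fact_neq0 // scale1r.
exact: integral_exp.
Qed.

Definition ps_trunc N a : {poly A} := \poly_(i < N) a i.

Lemma ps_trunc_mul N a b j : (j < N)%N ->
  ps_mul a b j = (ps_trunc N a * ps_trunc N b)`_j.
Proof.
move=> jN; rewrite coefM; apply: eq_bigr => i _.
by rewrite !coef_poly !(leq_trans _ jN) // ltnS leq_subr.
Qed.

Lemma ps_trunc_pow N a m j : (j < N)%N -> ps_pow a m j = (ps_trunc N a ^+ m)`_j.
Proof.
elim: m j => [|m IHm] j jN; first by rewrite expr0 coef1.
rewrite exprS coefM /ps_pow iterS -/(ps_pow a m) /ps_mul.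
apply: eq_bigr => i _.
rewrite coef_poly (leq_trans _ jN) // IHm //.
by apply: leq_ltn_trans jN; apply: leq_subr.
Qed.

Definition exptB1 c : nat -> A := ps_sub (ps_expt c) ps_one.

Lemma exptB1_0 c : exptB1 c 0 = 0.
Proof. by rewrite /exptB1 /ps_sub /ps_expt /ps_one invr1 scale1r subrr. Qed.

Lemma exptB1_S c j :
  exptB1 c j.+1 *+ j.+1 = c * (exptB1 c j + (j == 0%N)%:R).
Proof.
rewrite /exptB1 /ps_sub /ps_one subr0 subrK /ps_expt.
rewrite -scalerAr -exprS -scaler_nat scalerA factS natrM invfM mulrA mulfV.
  by rewrite mul1r.
by rewrite pnatr_eq0.
Qed.

Lemma pow_exptB1_S c m j :
  ps_pow (exptB1 c) m.+1 j.+1 *+ j.+1 =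
  (c * (ps_pow (exptB1 c) m.+1 j + ps_pow (exptB1 c) m j)) *+ m.+1.
Proof.
have jN : (j < j.+2)%N by [].
rewrite !(@ps_trunc_pow j.+2) //; set P := ps_trunc _ _.
rewrite -coef_deriv deriv_exp coefMn /=; congr (_ *+ _).
rewrite -coefD -[X in _ + X]mul1r exprS -mulrDl !coefM mulr_sumr.
apply: eq_bigr => i _; rewrite mulrA; congr (_ * _).
have ij : (i < j.+1)%N by [].
rewrite coef_deriv coefD coef1 !coef_poly ltnS ij (ltn_trans ij) //.
exact: exptB1_S.
Qed.

Lemma egf_integral_pow c m : integral c ->
  egf_integral (ps_scale (m`!%:R)^-1 (ps_pow (exptB1 c) m)).
Proof.
move=> hc; have int0 : integral 0 by exact: (integral_nat 0).
suff h j : integral ((j`!%:R / m`!%:R : rat) *: ps_pow (exptB1 c) m j).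
  by move=> j; rewrite /ps_scale scalerA.
elim: j m => [|j IHj] [|m].
- by rewrite /ps_pow /= /ps_one fact0 divr1 scale1r; exact: (integral_nat 1).
- rewrite /ps_pow iterS /ps_mul big_ord1 exptB1_0 mul0r scaler0.
  exact: int0.
- by rewrite /ps_pow /= /ps_one scaler0; exact: int0.
have -> : (j.+1`!%:R / m.+1`!%:R : rat) *: ps_pow (exptB1 c) m.+1 j.+1 =
    c * (m.+1%:R * ((j`!%:R / m.+1`!%:R : rat) *: ps_pow (exptB1 c) m.+1 j) +
         (j`!%:R / m`!%:R : rat) *: ps_pow (exptB1 c) m j).
  rewrite {1}factS mulnC natrM -mulrA [j.+1%:R * _]mulrC mulrA -scalerA.
  rewrite scaler_nat pow_exptB1_S -scaler_nat scalerA.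
  rewrite [m.+1%:R * (_ *: _)]mulr_natl -[(_ *: _) *+ _]scaler_nat scalerA.
  rewrite [m.+1%:R * _]mulrC.
  have -> : j`!%:R / m.+1`!%:R * m.+1%:R = j`!%:R / m`!%:R :> rat.
    rewrite factS mulnC natrM invfM mulrA mulfVK //.
    by rewrite pnatr_eq0.
  by rewrite -scalerDr scalerAr.
apply: integralM => //; apply: integralD; last exact: IHj.
by apply: integralM; [exact: integral_nat | exact: IHj].
Qed.

End Integrality.

Lemma stirling2_exists n (k : mindex n) (j : nat) :
  exists p : {mpoly int[n.+1]},
    map_mpoly (intr : int -> rat) p ==
    (j`!%:R : rat) *: stirling2_series k j.
Proof.
suff h : egf_integral (stirling2_series k).
  by have [p hp] := h j; exists p; apply/eqP.
rewrite /stirling2_series.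
set a := ps_expt _; set b := \big[_/_]_(i < n) _.
have -> : ps_scale (mindex_fact k)%:R^-1 (ps_mul a b) =
          ps_mul a (ps_scale (mindex_fact k)%:R^-1 b).
  apply: funext => l; rewrite /ps_scale /ps_mul scaler_sumr.
  by apply: eq_bigr => i _; rewrite scalerAr.
apply: egf_integral_mul; first exact/egf_integral_expt/integralX.
rewrite /b /mindex_fact natr_prod -prodfV.
apply: (big_rec2 (fun (c : rat) b => egf_integral (ps_scale c b)))
  => [l|i c e _ he].
  by rewrite /ps_scale scale1r; exact: egf_integral_one.
rewrite (_ : ps_scale _ _ =
  ps_mul (ps_scale ((k i)`!%:R)^-1 (ps_pow (exptB1 'X_(lift ord0 i)) (k i)))
         (ps_scale c e));
  first by apply: egf_integral_mul => //; apply/egf_integral_pow/integralX.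
apply: funext => l; rewrite /ps_scale /ps_mul scaler_sumr.
by apply: eq_bigr => m _; rewrite -scalerAl -scalerAr scalerA.
Qed.

(* S_k^(j)(x_0, ..., x_n); 'X_ord0 is x_0 and 'X_(lift ord0 i) is the variable
   attached to the i-th coordinate of k. *)
Definition stirling2 n (k : mindex n) (j : nat) : {mpoly int[n.+1]} :=
  xchoose (stirling2_exists k j).

Lemma stirling2_gf n (k : mindex n) (j : nat) :
  stirling2_series k j =
  (j`!%:R : rat)^-1 *: map_mpoly (intr : int -> rat) (stirling2 k j).
Proof.
rewrite (eqP (xchooseP (stirling2_exists k j))) scalerA mulVf ?fact_neq0 //.
by rewrite scale1r.
Qed.

Definition linear_form n (k : mindex n) : {mpoly int[n.+1]} :=
  'X_ord0 + \sum_(i < n) (k i)%:R * 'X_(lift ord0 i).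

Definition pascal_mx n (R : set (mindex n)) :
    omatrix {mpoly int[n.+1]} (index_of R) (index_of R) :=
  fun k k' => (mindex_bin (val k) (val k'))%:R.

Definition vandermonde_mx n (R : set (mindex n)) (l : nat) :
    omatrix {mpoly int[n.+1]} (index_of R) 'I_l.+1 :=
  fun k j => linear_form (val k) ^+ j.

Definition stirling_mx n (R : set (mindex n)) (l : nat) :
    omatrix {mpoly int[n.+1]} (index_of R) 'I_l.+1 :=
  fun k j => (mindex_fact (val k))%:R * stirling2 (val k) j.

Arguments pascal_mx {n} R _ _.
Arguments vandermonde_mx {n} R l _ _.
Arguments stirling_mx {n} R l _ _.

Lemma pascal_mx_finite_row n (R : set (mindex n)) (k : index_of R) :
  finite_set [set k' | pascal_mx R k k' != 0].
Proof.
pose s : seq 'X_{1..n} := [seq val m | m : 'X_{1..n < (mdeg (val k)).+1}].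
apply: (@sub_finite_set _ _ [set` (pmap insub s : seq (index_of R))]);
  last exact: finite_seq.
move=> k' /= hk'; rewrite mem_pmap_sub.
have le_kk' (i : 'I_n) : (val k' i <= val k i)%N.
  rewrite leqNgt; apply: contra hk' => lti.
  by rewrite /pascal_mx /mindex_bin (bigD1 i) //= bin_small.
have ltk' : (mdeg (val k') < (mdeg (val k)).+1)%N.
  by rewrite ltnS !mdegE; apply: leq_sum => i _.
by apply/mapP; exists (BMultinom ltk') => //; rewrite mem_enum.
Qed.

(* Main.v *)
(* Row k of the identity compares the coefficients of t^j in the expansion
     e^{A_k t} = e^{x_0 t} prod_i ((e^{x_i t} - 1) + 1)^{k_i}
       = sum_{k' <= k} binom(k, k') e^{x_0 t} prod_i (e^{x_i t} - 1)^{k'_i},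
   and every k' <= k lies in R because the complement of R is the set of
   exponents of an ideal. *)
Require Import Defs.
From mathcomp Require Import all_boot all_order all_algebra.
From mathcomp Require Import boolp classical_sets.
From mathcomp Require Import mpoly.
From HB Require Import structures.
From mathcomp Require Import functions fsbigop ring.

Set Implicit Arguments.
Unset Strict Implicit.
Unset Printing Implicit Defensive.

Import Order.TTheory GRing.Theory Num.Theory.

Local Open Scope ring_scope.
Local Open Scope classical_set_scope.

(* [nat -> _] carries the pointwise product; the alias carries the Cauchy one. *)
Definition pseries (n : nat) : Type := nat -> {mpoly rat[n]}.

HB.instance Definition _ n :=
  GRing.Lmodule.copy (pseries n) (nat -> {mpoly rat[n]}).

Section PowerSeriesRing.
Context {n : nat}.
Implicit Types a b c : pseries n.

(** The coefficient of [t^j] in a product depends only on coefficients of index at most [j], so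
    commutativity, and associativity below, are inherited from polynomials truncated at [j.+1]. *)
Lemma ps_mulC : commutative (ps_mul : pseries n -> pseries n -> pseries n).
Proof.
move=> a b; apply: funext => j.
by rewrite !(@ps_trunc_mul _ j.+1) // mulrC.
Qed.

Lemma ps_mulA : associative (ps_mul : pseries n -> pseries n -> pseries n).
Proof.
move=> a b c; apply: funext => j; pose T := @ps_trunc n j.+1.
have mulT d e i : (i <= j)%N -> ps_mul d e i = (T d * T e)`_i.
  by move=> ij; rewrite (@ps_trunc_mul _ j.+1).
transitivity ((T a * (T b * T c))`_j).
  rewrite coefM; apply: eq_bigr => i _.
  by rewrite coef_poly ltn_ord mulT ?leq_subr.
rewrite mulrA coefM; apply: eq_bigr => i _.
by rewrite coef_poly ltnS leq_subr mulT // -ltnS.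
Qed.

Lemma ps_mul1 : left_id (ps_one : pseries n) ps_mul.
Proof.
move=> a; apply: funext => j; rewrite /ps_mul big_ord_recl mul1r subn0.
by rewrite big1 ?addr0 // => i _; rewrite mul0r.
Qed.

Lemma ps_mulDl :
  left_distributive (ps_mul : pseries n -> pseries n -> pseries n) +%R.
Proof.
move=> a b c; apply: funext => j.
rewrite -[RHS]/(ps_mul a c j + ps_mul b c j) -big_split /=.
by apply: eq_bigr => i _; rewrite -mulrDl.
Qed.

End PowerSeriesRing.

HB.instance Definition _ n := GRing.Zmodule_isComPzRing.Build (pseries n)
  (@ps_mulA n) (@ps_mulC n) (@ps_mul1 n) (@ps_mulDl n).

Section PowerSeriesTheory.
Context {n : nat}.
Implicit Types (a : pseries n) (x y : {mpoly rat[n]}).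

Lemma ps_powE a m : ps_pow a m = a ^+ m.
Proof. by elim: m => // m IHm; rewrite exprS -IHm. Qed.

Lemma ps_mulrnE a m j : (a *+ m) j = a j *+ m.
Proof. by elim: m => // m IHm; rewrite !mulrS -IHm. Qed.

Lemma ps_exptD x y :
  ps_expt (x + y) = (ps_expt x : pseries n) * (ps_expt y : pseries n).
Proof.
(* [exprDn] puts the index [i] on the second summand; [addrC] makes that summand [x], as in the
   Cauchy product. *)
apply: funext => j; rewrite /ps_expt addrC exprDn scaler_sumr.
apply: eq_bigr => i _; rewrite mulrC -scalerAl -scalerAr scalerA.
rewrite -scaler_nat scalerA; congr (_ *: _).
have ij : (i <= j)%N by rewrite -ltnS.
rewrite -(bin_fact ij) !natrM; field.
by rewrite !fact_neq0 pnatr_eq0 -lt0n bin_gt0.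
Qed.

Lemma ps_expt0 : ps_expt 0 = 1 :> pseries n.
Proof.
apply: funext => -[|j]; rewrite /ps_expt ?invr1 ?scale1r //.
by rewrite expr0n scaler0.
Qed.

Lemma ps_expt_sum (I : Type) (r : seq I) (F : I -> {mpoly rat[n]}) :
  ps_expt (\sum_(i <- r) F i) = \prod_(i <- r) (ps_expt (F i) : pseries n).
Proof. exact: (big_morph (ps_expt : _ -> pseries n) ps_exptD ps_expt0). Qed.

Lemma ps_expt_nat x m : ps_expt (m%:R * x) = (ps_expt x : pseries n) ^+ m.
Proof.
elim: m => [|m IHm]; first by rewrite mul0r ps_expt0.
by rewrite exprS -IHm -ps_exptD -nat1r mulrDl mul1r.
Qed.

End PowerSeriesTheory.

(** Distributing a product over sums yields functions with a single codomain; [mdeg k] bounds every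
    coordinate of [k], so this codomain has room for every index below [k]. *)
Definition mnm_below n (k : mindex n) (f : {ffun 'I_n -> 'I_(mdeg k).+1}) :
    mindex n :=
  [multinom (f i : nat) | i < n].

Lemma prodMn_nat (A : comPzRingType) (I : Type) (r : seq I) (F : I -> A)
    (g : I -> nat) :
  \prod_(i <- r) (F i *+ g i) = (\prod_(i <- r) F i) *+ \prod_(i <- r) g i.
Proof.
rewrite -[RHS]mulr_natr natr_prod -big_split /=.
by apply: eq_bigr => i _; rewrite -[LHS]mulr_natr.
Qed.

(** ['X_[k]] is a multiple of ['X_[k']], so every ideal containing the latter contains the
    former. *)
Lemma monomial_condition_le n (R : set (mindex n)) (k k' : mindex n) :
  monomial_condition R -> R k -> (forall i, k' i <= k i)%N -> R k'.
Proof.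
move=> [J [[M ->] ->]] /= Rk le_k'k Jk'; apply: Rk => J' idJ' MJ'.
have [_ _ mulJ'] := idJ'.
have le_mnm : (k' <= k)%MM by apply/mnm_lepP.
rewrite -(submK le_mnm) mpolyXD; apply: mulJ'.
exact: Jk'.
Qed.

Section RowIdentity.
Context {n : nat}.
Implicit Types k : mindex n.

Lemma stirling2_seriesE k :
  (mindex_fact k)%:R *: (stirling2_series k : pseries n.+1) =
  (ps_expt 'X_ord0 : pseries n.+1) *
    \prod_(i < n) (exptB1 'X_(lift ord0 i) : pseries n.+1) ^+ k i.
Proof.
have fact_k : (mindex_fact k)%:R != 0 :> rat.
  by rewrite pnatr_eq0 -lt0n prodn_gt0 // => i; rewrite fact_gt0.
apply: funext => j; rewrite /stirling2_series /ps_scale.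
rewrite [LHS]scalerA mulfV // scale1r.
by under eq_bigr do rewrite ps_powE.
Qed.

Local Notation below k :=
  (fun (i : 'I_n) (j : 'I_(mdeg k).+1) => (j < (k i).+1)%N).

Lemma ps_expt_linear_form k :
  (ps_expt ('X_ord0 + \sum_(i < n) (k i)%:R * 'X_(lift ord0 i))
    : pseries n.+1) =
  \sum_(f in family (below k))
    (mindex_fact (mnm_below f))%:R *:
      (stirling2_series (mnm_below f) : pseries n.+1)
      *+ mindex_bin k (mnm_below f).
Proof.
rewrite ps_exptD ps_expt_sum.
pose B i : pseries n.+1 := exptB1 'X_(lift ord0 i).
have le_deg i : (k i <= mdeg k)%N by rewrite mdegE (bigD1 i) ?leq_addr.
under eq_bigr => i _.
  rewrite ps_expt_nat (_ : ps_expt _ = B i + 1 :> pseries _); last first.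
    by rewrite /B; apply: funext => j; rewrite [RHS]subrK.
  (* The range of each binomial sum depends on [i]; widening moves this dependence into the filter
     [below k]. *)
  rewrite exprD1n (big_ord_widen (mdeg k).+1 (fun j => B i ^+ j *+ 'C(k i, j)));
    last exact: le_deg.
  over.
rewrite bigA_distr_big_dep mulr_sumr; apply: eq_bigr => f _.
rewrite stirling2_seriesE prodMn_nat mulrnAr /mindex_bin.
congr (_ * _ *+ _).
  by apply: eq_bigr => i _; rewrite mnmE.
by apply: eq_bigr => i _; rewrite mnmE.
Qed.

(** This is [j!] times the coefficient of [t^j] in the series identity, read over the rationals and
    brought back to the integers by injectivity of [toQ]. *)
Lemma linear_form_exp k j :
  linear_form k ^+ j =
  \sum_(f in family (below k))
    (mindex_bin k (mnm_below f))%:R *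
      ((mindex_fact (mnm_below f))%:R * stirling2 (mnm_below f) j).
Proof.
pose toQ : {mpoly int[n.+1]} -> {mpoly rat[n.+1]} :=
  map_mpoly (intr : int -> rat).
have toQ_inj : injective toQ.
  move=> p q eqQ; apply/mpolyP => m; apply: (@intr_inj rat).
  by rewrite -!mcoeff_map_mpoly; congr (_@_m).
apply: toQ_inj.
have toQA : toQ (linear_form k) =
    'X_ord0 + \sum_(i < n) (k i)%:R * 'X_(lift ord0 i).
  rewrite /toQ /linear_form rmorphD rmorph_sum /= map_mpolyX; congr (_ + _).
  by apply: eq_bigr => i _; rewrite rmorphM rmorph_nat /= map_mpolyX.
have := congr1 (fun a : pseries n.+1 => (j`!%:R : rat) *: a j)
  (ps_expt_linear_form k).
rewrite -toQA /ps_expt scalerA mulfV ?fact_neq0 // scale1r.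
rewrite (_ : toQ (linear_form k ^+ j) = toQ (linear_form k) ^+ j); last first.
  exact: rmorphXn.
move=> ->; rewrite fct_sumE scaler_sumr [RHS]rmorph_sum; apply: eq_bigr => f _.
rewrite !rmorphM !rmorph_nat.
set g := mnm_below f.
rewrite mulr_natl [X in _ *: X](_ : _ =
   ((mindex_fact g)%:R *: stirling2_series g j) *+ mindex_bin k g); last first.
  exact: ps_mulrnE.
rewrite -scalerMnr stirling2_gf !scalerA mulrAC mulfV ?fact_neq0 // mul1r.
by rewrite scaler_nat mulr_natl.
Qed.

End RowIdentity.

Theorem theorem1 (n : nat) (hn : (1 <= n)%N)
    (R : set (mindex n)) (hR : monomial_condition R)
    (l : nat) (hl : (0 < l)%N) :
  omulmx (pascal_mx R) (stirling_mx R l) = vandermonde_mx R l.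
Proof.
apply: funext => -[k Rk]; apply: funext => j.
rewrite /vandermonde_mx /= linear_form_exp /omulmx.
set Q := family _.
have le_f f : f \in Q -> mnm_below f \in R.
  move=> /familyP fk; rewrite inE.
  apply: (monomial_condition_le hR (set_mem Rk)).
  by move=> i; rewrite mnmE -ltnS; exact: fk.
(* The default value [k] is never taken on [Q], by [le_f]. *)
pose h (f : {ffun 'I_n -> 'I_(mdeg k).+1}) : index_of R :=
  insubd (exist _ k Rk : index_of R) (mnm_below f).
have valh f : f \in Q -> val (h f) = mnm_below f.
  by move=> /le_f fR; rewrite /h val_insubd fR.
(* Remaining: the sum over this list is the expansion, the list has no duplicates, and the summand
   vanishes off it. *)
rewrite (fsbigE [seq h f | f in Q]) //=.
- under eq_bigl do rewrite in_setT.
  rewrite big_image /=; apply: eq_bigr => f fQ.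
  by rewrite /pascal_mx /stirling_mx valh.
- rewrite map_inj_in_uniq ?enum_uniq // => f g.
  rewrite !mem_enum => fQ gQ /(congr1 val); rewrite !valh // => fg.
  apply/ffunP => i; apply: val_inj.
  by move/mnmP: fg => /(_ i); rewrite !mnmE.
- move=> k' _ /negP nk'; rewrite /pascal_mx /mindex_bin.
  (* If some coordinate of [k'] exceeds that of [k], a binomial factor is zero. *)
  have [/forallP le_k'|] := boolP [forall i, (val k' i <= k i)%N]; last first.
    rewrite negb_forall => /existsP[i]; rewrite -ltnNge => lt_k.
    by rewrite (bigD1 i) //= bin_small // mul0n mul0r.
  (* Otherwise [k'] is in the list after all, as the image of its own coordinates; these are at most
     [mdeg k], so [inord] preserves them. *)
  case: nk'; apply/mapP.
  have le_deg i : (val k' i <= mdeg k)%N.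
    by rewrite (leq_trans (le_k' i)) // mdegE (bigD1 i) ?leq_addr.
  pose f := [ffun i => inord (val k' i) : 'I_(mdeg k).+1].
  have fE i : f i = val k' i :> nat by rewrite ffunE inordK // ltnS.
  have fQ : f \in Q by apply/familyP => i;
    rewrite -[_ \in _]/(f i < (k i).+1)%N fE ltnS.
  exists f; first by rewrite mem_enum.
  apply: val_inj; rewrite valh //.
  by apply/mnmP => i; rewrite mnmE fE.
Qed.
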